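(* Let $n\ge2$, $0<a\le1$, let $G$ be the free group on $u_1,\dots,u_n$, let $\phi(s)=a^{|s|-2\gamma(s)}b^{\gamma(s)}$ with $b=\frac{na^2-1}{n-1}$, and let $\pi$ be the unitary representation of $G$ on $H$, with vector $\Delta_1\in H$, constructed in the context. Then $\phi(s)=\langle\pi(s)\Delta_1,\Delta_1\rangle$ for all $s\in G$.
   Context: For $s\in G$ (a reduced word in $u_1^{\pm1},\dots,u_n^{\pm1}$), $|s|$ is its length and $\gamma(s)$ is the number of positions where a letter $u_i^{-1}$ is immediately followed by a letter $u_j$. Convention $0^0=1$. $G^+$ is the unital subsemigroup of $G$ generated by $u_1,\dots,u_n$. Construction of $\pi$. $H_0$ is the Hilbert space that is the closed linear span of vectors $\{\Delta_s:s\in G^+\}$ satisfying $\langle\Delta_t,\Delta_s\rangle=\phi(s^{-1}t)$ and $\sum_{i=1}^n\Delta_{su_i}=na\,\Delta_s$ for $s,t\in G^+$. (It exists because the matrices $(\phi(s^{-1}t))_{s,t}$ indexed by the words of length $k$ in $G^+$ are positive semidefinite for every $k$, and $\sum_i\phi(xu_i)=na\,\phi(x)=\sum_i\phi(u_i^{-1}x)$ for $x\in G$; it is the inductive limit of the finite-dimensional spaces $E_k$ spanned by $\Delta_s$, $s\in G^+$, $|s|=k$, under the isometries $\Delta_s\mapsto(na)^{-1}\sum_i\Delta_{su_i}$.) For each $i$, $V_i$ is the isometry of $H_0$ with $V_i\Delta_s=\Delta_{u_is}$, and $H_i'=H_0\ominus V_iH_0$. $S_i^-\subset G$ is the set of reduced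 words whose last letter is $u_i^{-1}$, with $\{\delta_s\}$ the standard orthonormal basis of $\ell^2(S_i^-)$. Put $$H=H_0\oplus\bigoplus_{i=1}^n\bigl(\ell^2(S_i^-)\otimes H_i'\bigr).$$ For each $i$, $U_i$ is the unitary on $H$ which equals $V_i$ on $H_0$, sends $\delta_{u_i^{-1}}\otimes\eta$ to $\eta\in H_i'\subset H_0$ for $\eta\in H_i'$, and sends $\delta_s\otimes\eta$ to $\delta_{u_is}\otimes\eta$ for all other $s\in\bigcup_jS_j^-$ (with $\eta\in H_j'$ when $s\in S_j^-$). $\pi$ is the unitary representation of $G$ on $H$ with $\pi(u_i)=U_i$. *)

(* Defs.v *)
From HB Require Import structures.
From mathcomp Require Import all_boot all_order all_algebra.
From mathcomp Require Import complex.
From mathcomp Require Import all_classical all_reals.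
From mathcomp Require Import topology normedtype.

Set Implicit Arguments.
Unset Strict Implicit.
Unset Printing Implicit Defensive.

Import Order.TTheory GRing.Theory Num.Theory.
Import numFieldNormedType.Exports.

Local Open Scope classical_set_scope.
Local Open Scope ring_scope.

(* (i, false) is the letter u_i, (i, true) is the letter u_i^-1. *)
Definition letter (n : nat) : Type := ('I_n * bool)%type.

Section FreeGroup.
Variable n : nat.
Implicit Types (x y : letter n) (u v w : seq (letter n)).

Definition letter_inv x : letter n := (x.1, ~~ x.2).

Lemma letter_invK : involutive letter_inv.
Proof. by case=> i b; rewrite /letter_inv /= negbK. Qed.

Definition reduced w : bool := sorted (fun x y => y != letter_inv x) w.

Record free_group : Type :=
  FreeGroup { word :> seq (letter n); word_reduced : reduced word }.

HB.instance Definition _ := [isSub for word].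
HB.instance Definition _ := [Choice of free_group by <:].

(* The reduced form of x :: w, when w is reduced. *)
Definition reduce_cons x w : seq (letter n) :=
  if w is y :: w' then if y == letter_inv x then w' else x :: w else [:: x].

(* The reduced form of u ++ v, when v is reduced. *)
Definition word_mul u v : seq (letter n) := foldr reduce_cons v u.

Definition word_inv u : seq (letter n) := rev (map letter_inv u).

Lemma reduced_behead x w : reduced (x :: w) -> reduced w.
Proof. by case: w => //= y w /andP[]. Qed.

Lemma reduce_cons_reduced x w : reduced w -> reduced (reduce_cons x w).
Proof.
case: w => //= y w; case: ifPn => [_|yx] yw; first exact: reduced_behead yw.
by rewrite /reduced /= yx.
Qed.

Lemma word_mul_reduced u v : reduced v -> reduced (word_mul u v).
Proof. by move=> v_red; elim: u => //= x u; apply: reduce_cons_reduced. Qed.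

Lemma reduced_cons x w : reduced (x :: w) -> reduce_cons x w = x :: w.
Proof. by case: w => //= y w /andP[/negbTE ->]. Qed.

Lemma reduce_consK x w : reduced w ->
  reduce_cons (letter_inv x) (reduce_cons x w) = w.
Proof.
case: w => [_|y w yw] /=; first by rewrite letter_invK eqxx.
case: eqP => [<-|_] /=; first exact: reduced_cons.
by rewrite letter_invK eqxx.
Qed.

Lemma word_mulw1 u : reduced u -> word_mul u [::] = u.
Proof.
elim: u => //= x u IHu xu; rewrite IHu ?(reduced_behead xu) //.
exact: reduced_cons.
Qed.

Lemma word_mul_cons x v w : reduced v -> reduced w ->
  word_mul (reduce_cons x v) w = reduce_cons x (word_mul v w).
Proof.
case: v => //= y v yv w_red; case: eqP => //= ->.
rewrite -{1}[x]letter_invK reduce_consK //; exact: word_mul_reduced.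
Qed.

Lemma word_mulA u v w : reduced v -> reduced w ->
  word_mul u (word_mul v w) = word_mul (word_mul u v) w.
Proof.
move=> v_red w_red; elim: u => //= x u ->.
by rewrite word_mul_cons //; apply: word_mul_reduced.
Qed.

Lemma word_mulVw u v : reduced v -> word_mul (word_inv u) (word_mul u v) = v.
Proof.
move=> v_red; elim: u => //= x u IHu.
rewrite /word_inv /= rev_cons /word_mul foldr_rcons reduce_consK //.
exact: word_mul_reduced.
Qed.

Lemma word_invK : involutive word_inv.
Proof.
move=> u; rewrite /word_inv map_rev revK -map_comp map_id_in // => x _.
exact: letter_invK.
Qed.

Lemma word_inv_reduced u : reduced u -> reduced (word_inv u).
Proof.
rewrite /reduced /word_inv rev_sorted sorted_map.
apply: sub_sorted => x y /=; apply: contra => /eqP ->.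
by rewrite !letter_invK.
Qed.

Definition free_one : free_group := @FreeGroup [::] isT.
Definition free_mul (s t : free_group) : free_group :=
  FreeGroup (word_mul_reduced s (word_reduced t)).
Definition free_inv (s : free_group) : free_group :=
  FreeGroup (word_inv_reduced (word_reduced s)).

Lemma free_mulA : associative free_mul.
Proof. by move=> s t r; apply/val_inj/word_mulA; apply: word_reduced. Qed.

Lemma free_mul1g : left_id free_one free_mul.
Proof. by move=> s; apply/val_inj. Qed.

Lemma free_mulg1 : right_id free_one free_mul.
Proof. by move=> s; apply/val_inj/word_mulw1/word_reduced. Qed.

Lemma free_invK : involutive free_inv.
Proof. by move=> s; apply/val_inj/word_invK. Qed.

Lemma free_mulVg : left_inverse free_one free_inv free_mul.
Proof.
move=> s; apply/val_inj => /=.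
by rewrite -{2}[word s]word_mulw1 ?word_reduced // word_mulVw.
Qed.

Lemma free_mulgV : right_inverse free_one free_inv free_mul.
Proof. by move=> s; rewrite -{1}[s]free_invK free_mulVg. Qed.

HB.instance Definition _ := isGroup.Build free_group
  free_mulA free_mul1g free_mulg1 free_mulVg free_mulgV.

Definition free_gen (i : 'I_n) : free_group := @FreeGroup [:: (i, false)] isT.

(* G^+, the unital subsemigroup generated by the free generators. *)
Inductive free_pos : set free_group :=
| free_pos1 : free_pos 1%g
| free_pos_gen i : free_pos (free_gen i)
| free_posM s t : free_pos s -> free_pos t -> free_pos (s * t)%g.

Definition ends_with_inv (i : 'I_n) : set free_group :=
  [set s | exists w, word s = rcons w (i, true)].

(* gamma(s): the number of positions where an inverse letter is immediately
   followed by a generator. *)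
Definition turns (s : free_group) : nat :=
  count (fun xy => xy.1.2 && ~~ xy.2.2) (zip (word s) (behead (word s))).

(* The truncated subtraction is harmless: the positions counted by [turns]
   occupy disjoint pairs of letters, so that 2 * turns s <= size s. *)
Definition phi (R : realType) (a : R) (s : free_group) : R :=
  let b := (n%:R * a ^+ 2 - 1) / (n%:R - 1) in
  a ^+ (size (word s) - 2 * turns s) * b ^+ turns s.

End FreeGroup.

(* The inner product is linear in its first argument. *)
HB.mixin Record NormedModule_isHilbert (R : realType) V
    of CompleteNormedModule R[i] V := {
  dotp : V -> V -> R[i] ;
  dotpP : forall (c : R[i]) (x y z : V),
    dotp (c *: x + y) z = c * dotp x z + dotp y z ;
  dotpC : forall x y : V, dotp x y = (dotp y x)^* ;
  dotp_norm : forall x : V, dotp x x = `|x| ^+ 2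
}.

#[short(type="hilbertType")]
HB.structure Definition Hilbert (R : realType) :=
  {V of CompleteNormedModule R[i] V & NormedModule_isHilbert R V}.

Notation "''[' u , v ]" := (dotp u v) : ring_scope.

Section DotpInstance.
Variables (R : realType) (V : hilbertType R).

Fact dotp_bilinear : bilinear_for
  (GRing.Scale.Law.clone _ _ ( *%R ) _)
  (GRing.Scale.Law.clone _ _ (Num.conj \; *%R) _) (@dotp R V).
Proof.
split=> [z c x y|z c x y] /=; first exact: dotpP.
by rewrite dotpC dotpP rmorphD rmorphM /= -!dotpC.
Qed.

HB.instance Definition _ :=
  bilinear_isBilinear.Build R[i] V V R[i] _ _ (@dotp R V) dotp_bilinear.

Fact dotp_hermitian (x y : V) : '[x, y] = (-1) ^+ false * Num.conj '[y, x].
Proof. by rewrite mul1r -dotpC. Qed.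

HB.instance Definition _ :=
  isHermitianSesquilinear.Build R[i] V false Num.conj (@dotp R V)
    dotp_hermitian.

Fact dotp_gt0 (x : V) : x != 0 -> 0 < '[x, x].
Proof. by move=> x0; rewrite dotp_norm exprn_gt0 // normr_gt0. Qed.

HB.instance Definition _ := isDotProduct.Build R[i] V (@dotp R V) dotp_gt0.

End DotpInstance.

Section HilbertNotions.
Variable R : realType.

Definition lin_span (V : hilbertType R) (A : set V) : set V :=
  [set x | exists (k : nat) (c : 'I_k -> R[i]) (v : 'I_k -> V),
     (forall i, A (v i)) /\ x = \sum_i c i *: v i].

Definition closed_span (V : hilbertType R) (A : set V) : set V :=
  closure (lin_span A).

Definition isometric (V W : hilbertType R) (f : V -> W) : Prop :=
  forall x y, '[f x, f y] = '[x, y].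

Definition unitary (V : hilbertType R) (f : V -> V) : Prop :=
  isometric f /\ range f = setT.

Definition unitary_representation (G : groupType) (V : hilbertType R)
    (pi : G -> {linear V -> V}) : Prop :=
  [/\ forall s, unitary (pi s),
      forall x, pi 1%g x = x &
      forall s t x, pi (s * t)%g x = pi s (pi t x)].

(* V is l^2(A), with standard orthonormal basis (e s) for s in A; the values
   of e outside A are irrelevant. *)
Definition orthonormal_basis (I : Type) (A : set I) (V : hilbertType R)
    (e : I -> V) : Prop :=
  [/\ forall s, A s -> '[e s, e s] = 1,
      forall s t, A s -> A t -> s <> t -> '[e s, e t] = 0 &
      closed_span (e @` A) = setT].

(* T, with tens x y in the role of the elementary tensor of x and y, is the
   Hilbert space tensor product of V and W. *)
Definition hilbert_tensor (V W T : hilbertType R)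
    (tens : {bilinear V -> W -> T}) : Prop :=
  (forall x y x' y', '[tens x y, tens x' y'] = '[x, x'] * '[y, y']) /\
  closed_span [set z | exists x y, z = tens x y] = setT.

(* V is the Hilbert space direct sum of V0 and of the K i, through the given
   embeddings. *)
Definition hilbert_direct_sum (I : Type) (V0 : hilbertType R)
    (K : I -> hilbertType R) (V : hilbertType R)
    (inj0 : {linear V0 -> V}) (inj : forall i, {linear K i -> V}) : Prop :=
  [/\ isometric inj0 /\ (forall i, isometric (inj i)),
      forall i x y, '[inj0 x, inj i y] = 0,
      forall i j x y, i <> j -> '[inj i x, inj j y] = 0 &
      closed_span (range inj0 `|` \bigcup_i range (inj i)) = setT].

End HilbertNotions.

Section OrthogonalComplement.
Variables (R : realType) (V : hilbertType R).

Lemma dotpPr (c : R[i]) (x y z : V) :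
  '[z, c *: x + y] = c^* * '[z, x] + '[z, y].
Proof. by rewrite dotpC dotpP rmorphD rmorphM /= -!dotpC. Qed.

Lemma dotp_CauchySchwarz (x y : V) : `|'[x, y]| <= `|x| * `|y|.
Proof.
have [->|y0] := eqVneq y 0; first by rewrite linear0r !normr0 mulr0.
have yy0 : '[y, y] != 0 by rewrite dnorm_eq0.
pose a := '[x, y] / '[y, y]; pose z := x - a *: y.
have zy : '[z, y] = 0.
  by rewrite linearBl /= linearZl_LR /= /a divfK // subrr.
have zyC : '[y, z] = 0 by rewrite dotpC zy conjC0.
have xyE : '[x, y] = a * '[y, y] by rewrite /a divfK.
have xxE : '[x, x] = '[z, z] + `|a| ^+ 2 * '[y, y].
  rewrite -[x in LHS](subrK (a *: y)) -/z addrC dotpP !dotpPr zy zyC.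
  by rewrite mulr0 addr0 add0r mulrA addrC normCK.
have sq0 : `|'[x, y]| ^+ 2 <= (`|x| * `|y|) ^+ 2.
  rewrite exprMn -!dotp_norm xxE xyE normrM exprMn (ger0_norm (dnorm_ge0 _ _)).
  rewrite mulrDl expr2 mulrA lerDr mulr_ge0 //; exact: dnorm_ge0.
by move: sq0; rewrite ler_pXn2r // ?nnegrE ?mulr_ge0.
Qed.

Variable A : set V.

Definition orthogonal_to : {pred V} :=
  fun x => `[< forall y, A y -> '[x, y] = 0 >].

Lemma orthogonal_toP x :
  reflect (forall y, A y -> '[x, y] = 0) (x \in orthogonal_to).
Proof. exact: asboolP. Qed.

Record orthocompl : Type :=
  OrthoCompl { orthocompl_val :> V;
               orthocompl_valP : orthocompl_val \in orthogonal_to }.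

HB.instance Definition _ := [isSub for orthocompl_val].
HB.instance Definition _ := [Choice of orthocompl by <:].

Lemma orthogonal_to_submod : submod_closed orthogonal_to.
Proof.
split=> [|c x y /orthogonal_toP xA /orthogonal_toP yA].
  by apply/orthogonal_toP => y _; rewrite linear0l.
apply/orthogonal_toP => z Az.
by rewrite linearDl /= linearZl_LR /= xA // yA // mulr0 addr0.
Qed.

HB.instance Definition _ :=
  GRing.isSubmodClosed.Build _ _ orthogonal_to orthogonal_to_submod.
HB.instance Definition _ := [SubChoice_isSubLmodule of orthocompl by <:].

Let nm (x : orthocompl) : R[i] := `|val x|.

Let nmD x y : nm (x + y) <= nm x + nm y.
Proof. exact: ler_normD. Qed.

Let nmZ (c : R[i]) x : nm (c *: x) = `|c| * nm x.
Proof. exact: normrZ. Qed.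

Let nm0_eq0 x : nm x = 0 -> x = 0.
Proof. by move=> /normr0_eq0 x0; apply/val_inj; rewrite x0. Qed.

HB.instance Definition _ :=
  Lmodule_isNormed.Build R[i] orthocompl nmD nmZ nm0_eq0.

Let compl_complete (F : set_system orthocompl) :
  ProperFilter F -> cauchy F -> cvg F.
Proof.
move=> FF F_cauchy.
have G_cauchy : cauchy (val @ F).
  apply/cauchy_ballP => e e0; move/cauchy_ballP : F_cauchy => /(_ e e0).
  rewrite !near_simpl; move=> [[P Q] /= [FP FQ] PQ].
  exists (val @` P, val @` Q) => /=.
    split; rewrite nbhs_filterE /=.
      by apply: filterS FP => x Px; exists x.
    by apply: filterS FQ => x Qx; exists x.
  move=> [_ _] /= [[x Px <-] [y Qy <-]].
  have := PQ (x, y) (conj Px Qy); rewrite -!ball_normE; exact.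
have Gl : val @ F --> lim (val @ F) by apply: cauchy_cvg.
move: (lim (val @ F)) Gl => l Gl.
have l_near e : 0 < e -> \forall x \near F, `|l - val x| < e.
  by move=> e0; move/cvgrPdist_lt : Gl => /(_ e e0); rewrite near_map.
have lA : l \in orthogonal_to.
  apply/orthogonal_toP => y Ay; apply/eqP/negPn/negP => ly0.
  have y0 : 0 < `|y|.
    by rewrite normr_gt0; apply: contra ly0 => /eqP ->; rewrite linear0r.
  have e0 : 0 < `|'[l, y]| / `|y| by rewrite divr_gt0 // normr_gt0.
  have [x] := filter_ex (l_near _ e0).
  rewrite ltr_pdivlMr // => /(le_lt_trans (dotp_CauchySchwarz _ _)).
  have /orthogonal_toP/(_ _ Ay) xy0 := valP x.
  by rewrite linearBl /= xy0 subr0 ltxx.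
apply: (@cvgP _ _ (OrthoCompl lA)); apply/cvgrPdist_lt => e e0.
exact: l_near.
Qed.

HB.instance Definition _ := Uniform_isComplete.Build orthocompl compl_complete.

Let dot (x y : orthocompl) : R[i] := '[val x, val y].

Let dotP (c : R[i]) (x y z : orthocompl) :
  dot (c *: x + y) z = c * dot x z + dot y z.
Proof. exact: dotpP. Qed.

Let dotC (x y : orthocompl) : dot x y = (dot y x)^*.
Proof. exact: dotpC. Qed.

Let dot_norm (x : orthocompl) : dot x x = `|x| ^+ 2.
Proof. exact: dotp_norm. Qed.

HB.instance Definition _ :=
  NormedModule_isHilbert.Build R orthocompl dotP dotC dot_norm.

End OrthogonalComplement.

(* Main.v *)
Require Import Defs.
From mathcomp Require Import all_boot all_order all_algebra.
From mathcomp Require Import complex.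
From mathcomp Require Import all_classical all_reals.
From mathcomp Require Import topology normedtype.
From mathcomp Require Import zify.

Set Implicit Arguments.
Unset Strict Implicit.
Unset Printing Implicit Defensive.

Import Order.TTheory GRing.Theory Num.Theory.
Import numFieldNormedType.Exports.

Local Open Scope classical_set_scope.
Local Open Scope ring_scope.
Local Open Scope complex_scope.

(* Split a reduced word s which is not positive at its last inverse letter,
   s = s' u_i^-1 r with r positive not starting with u_i. Then
   phi (s' u_i^-1 r) = phi s' * phi (u_i^-1 r), because no position counted by
   gamma straddles the cut. Taking s' the inverse of a positive word, this says
   that eta = Delta_r - phi (u_i^-1 r) Delta_(u_i) is orthogonal to the range
   of V_i, hence
     pi (u_i^-1) Delta_r = phi (u_i^-1 r) Delta_1 + delta_(u_i^-1) (x) eta.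
   As s' u_i^-1 is reduced, pi s' sends the second term to
   delta_(s' u_i^-1) (x) eta, which is orthogonal to H_0, so the coefficient
   <pi s Delta_1, Delta_1> obeys the same recursion as phi. *)

(** * Reduced words, positive words and turns *)

Section Words.
Variable n : nat.
Implicit Types (x : letter n) (u v w : seq (letter n)) (s t : free_group n).

Lemma reduced_cat u x v :
  reduced (u ++ x :: v) = reduced (rcons u x) && reduced (x :: v).
Proof.
case: u => [|y u]; first by [].
by rewrite /reduced /= cat_path rcons_path /= -andbA.
Qed.

Lemma word_mul_cat u v : reduced (u ++ v) -> word_mul u v = u ++ v.
Proof.
elim: u => //= x u IHu xuv; rewrite IHu ?(reduced_behead xuv) //.
exact: reduced_cons.
Qed.

(** Cancellation needs two adjacent letters of opposite signs. *)
Lemma reduced_same_sign (b : bool) w : all (fun x => x.2 == b) w -> reduced w.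
Proof.
case: w => //= x w; elim: w x => //= y w IHw x /and3P[/eqP xb /eqP yb wb].
rewrite /reduced /= IHw ?yb ?eqxx // andbT; apply/eqP => yx.
by move: yb; rewrite yx /= xb; case: (b).
Qed.

Definition positive_word w := all (fun x => x.2 == false) w.

Lemma word_mulg_cat s t : reduced (word s ++ word t) ->
  word (s * t)%g = word s ++ word t.
Proof. exact: word_mul_cat. Qed.

Lemma free_group_cons i b w (w_red : reduced ((i, b) :: w)) :
  FreeGroup w_red = ((if b then (free_gen i)^-1 else free_gen i)
                     * FreeGroup (reduced_behead w_red))%g.
Proof. by apply/val_inj; case: b w_red => w_red; rewrite [RHS]word_mulg_cat. Qed.

Lemma free_pos_word s : free_pos s -> positive_word (word s).
Proof.
elim=> {s} // s t _ IHs _ IHt.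
have st : positive_word (word s ++ word t).
  by rewrite /positive_word all_cat; apply/andP.
by rewrite word_mulg_cat ?(reduced_same_sign st).
Qed.

Lemma positive_word_free_pos s : positive_word (word s) -> free_pos s.
Proof.
case: s => w /=; elim: w => [|[i b] w IHw] w_red /=.
  have -> : FreeGroup w_red = 1%g by apply/val_inj.
  by move=> _; apply: free_pos1.
case/andP=> /= /eqP b0 w_pos; rewrite b0 in w_red *.
by rewrite free_group_cons; apply: free_posM; [apply: free_pos_gen | apply: IHw].
Qed.

Lemma positive_or_last_inverse w : positive_word w \/
  exists u i v, w = u ++ (i, true) :: v /\ positive_word v.
Proof.
elim: w => [|[i b] w [w_pos|[u [j [v [-> v_pos]]]]]]; first by left.
- by case: b; [right; exists [::], i, w | left].
- by right; exists ((i, b) :: u), j, v.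
Qed.

Lemma free_pos_or_last_inverse s : free_pos s \/
  exists s' i r, [/\ free_pos r, word s = word s' ++ (i, true) :: word r &
    s = (s' * ((free_gen i)^-1 * r))%g].
Proof.
have [/positive_word_free_pos|] := positive_or_last_inverse (word s).
  by left.
move=> [u [i [v [sE v_pos]]]]; right.
have := word_reduced s; rewrite sE => uv.
have := uv; rewrite reduced_cat => /andP[ui iv].
have [u_red _] := cat_sorted2 uv.
have v_red := reduced_behead iv.
exists (FreeGroup u_red), i, (FreeGroup v_red); split=> //.
  exact: positive_word_free_pos.
have irE : word ((free_gen i)^-1 * FreeGroup v_red)%g = (i, true) :: v.
  by rewrite word_mulg_cat.
by apply/val_inj; rewrite -[LHS]/(word s) [RHS]word_mulg_cat irE.
Qed.

Lemma positive_word_inv_cat s t i :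
  free_pos s -> reduced ((i, true) :: word t) ->
  reduced (word s^-1%g ++ (i, true) :: word t).
Proof.
move=> /free_pos_word s_pos it; rewrite reduced_cat it andbT.
apply: (@reduced_same_sign true); rewrite all_rcons /= all_rev all_map.
by apply: sub_all s_pos => x /= /eqP ->.
Qed.

(** [turns] on bare words, so that induction need not carry reducedness. *)
Definition word_turns w : nat :=
  count (fun xy => xy.1.2 && ~~ xy.2.2) (zip w (behead w)).

(** The pair straddling the cut ends in an inverse letter, so it is not a turn. *)
Lemma word_turns_cat u i v :
  word_turns (u ++ (i, true) :: v)
  = (word_turns u + word_turns ((i, true) :: v))%N.
Proof.
rewrite /word_turns; elim: u => [|x [|y u] IHu] //=; first by rewrite andbF.
by rewrite -addnA -IHu.
Qed.

Lemma word_turns_le w : (2 * word_turns w <= size w)%N.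
Proof.
(* A turn cannot open at a generator, so a word starting with one has a letter to spare; [x.2]
   records this and lets the induction close. *)
suff H x v : (2 * word_turns (x :: v) <= size v + x.2)%N.
  by case: w => // x w; apply: leq_trans (H x w) _; case: x.2 => /=; lia.
elim: v x => [|y v IHv] x; first by [].
have := IHv y; rewrite /word_turns /=.
by case: x.2; case: y.2 => /=; lia.
Qed.

End Words.

(** * Multiplicativity of [phi] at a cut before an inverse letter *)

Section Phi.
Variables (R : realType) (n : nat) (a : R).
Implicit Types (s t : free_group n).

Lemma phi_cat s t i v : word t = (i, true) :: v -> reduced (word s ++ word t) ->
  phi a (s * t)%g = phi a s * phi a t.
Proof.
move=> tE st; rewrite /phi.
have -> : turns (s * t)%g = (turns s + turns t)%N.
  by rewrite /turns word_mulg_cat // tE; apply: word_turns_cat.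
rewrite word_mulg_cat // size_cat mulrACA -!exprD; congr (_ ^+ _ * _).
(* These bounds keep the truncated subtractions in the exponents of [a] additive. *)
have Hs : (2 * turns s <= size (word s))%N := word_turns_le (word s).
have Ht : (2 * turns t <= size (word t))%N := word_turns_le (word t).
by lia.
Qed.

End Phi.

(** * Orthogonality passes to closed spans *)

Section Hilbert.
Variable R : realType.

Lemma isometric_norm (V W : hilbertType R) (f : V -> W) (x : V) :
  isometric f -> `|f x| = `|x|.
Proof.
move=> f_iso; apply/eqP; rewrite -(@eqrXn2 _ 2) // -!dotp_norm; apply/eqP.
exact: f_iso.
Qed.

Lemma orthogonal_closed_span (V W : hilbertType R) (f : {linear V -> W})
    (A : set V) (x : W) :
  isometric f -> (forall y, A y -> '[x, f y] = 0) ->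
  forall y, closed_span A y -> '[x, f y] = 0.
Proof.
move=> f_iso xA y Ay.
have x_span z : lin_span A z -> '[x, f z] = 0.
  move=> [k [c [v [vA ->]]]]; rewrite linear_sum linear_sumr big1 /= // => j _.
  have -> : f (c j *: v j) = c j *: f (v j) + 0 by rewrite addr0 linearZ.
  by rewrite dotpPr linear0r xA // mulr0 addr0.
apply/eqP/negPn/negP => xy0.
have x0 : 0 < `|x|.
  by rewrite normr_gt0; apply: contra xy0 => /eqP ->; rewrite linear0l.
(* A span element z this close to y would, by Cauchy-Schwarz, force |<x, f y>| = |<x, f (y - z)>| to
   be less than itself. *)
have e0 : 0 < `|'[x, f y]| / `|x| by rewrite divr_gt0 // normr_gt0.
have [z [/x_span xz]] := Ay _ (nbhsx_ballx y _ e0).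
rewrite -ball_normE /= ltr_pdivlMr // mulrC -(isometric_norm _ f_iso).
move=> /(le_lt_trans (dotp_CauchySchwarz _ _)).
by rewrite linearB linearBr /= xz subr0 ltxx.
Qed.

End Hilbert.

(** * Action of [pi] and its coefficient at [Delta 1] *)

Theorem proposition2p3 (R : realType) (n : nat) (a : R)
  (n_ge2 : (2 <= n)%N) (a_gt0 : 0 < a) (a_le1 : a <= 1)
  (* H_0 and the vectors Delta_s, s in G^+ *)
  (H0 : hilbertType R) (Delta : free_group n -> H0)
  (Delta_span : closed_span (Delta @` @free_pos n) = setT)
  (Delta_gram : forall s t, free_pos s -> free_pos t ->
     '[Delta t, Delta s] = (phi a (s^-1 * t)%g)%:C)
  (Delta_sum : forall s, free_pos s ->
     \sum_(i < n) Delta (s * free_gen i)%g = (n%:R * a)%:C *: Delta s)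
  (* the isometries V_i; H_i' is orthocompl (range (V i)) *)
  (V : 'I_n -> {linear H0 -> H0})
  (V_isometric : forall i, isometric (V i))
  (V_Delta : forall i s, free_pos s ->
     V i (Delta s) = Delta (free_gen i * s)%g)
  (* L i is l^2(S_i^-), with standard basis delta i *)
  (L : 'I_n -> hilbertType R) (delta : forall i, free_group n -> L i)
  (delta_basis : forall i, orthonormal_basis (ends_with_inv i) (delta i))
  (* K i is the tensor product of l^2(S_i^-) and H_i' *)
  (K : 'I_n -> hilbertType R)
  (tens : forall i, {bilinear L i -> orthocompl (range (V i)) -> K i})
  (tens_hilbert : forall i, hilbert_tensor (tens i))
  (* H is the direct sum of H_0 and of the K i *)
  (H : hilbertType R) (inj0 : {linear H0 -> H})
  (inj : forall i, {linear K i -> H})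
  (H_sum : hilbert_direct_sum inj0 inj)
  (U : 'I_n -> {linear H -> H})
  (U_unitary : forall i, unitary (U i))
  (U_H0 : forall i x, U i (inj0 x) = inj0 (V i x))
  (U_inv : forall i (eta : orthocompl (range (V i))),
     U i (inj i (tens i (delta i (free_gen i)^-1%g) eta)) = inj0 (val eta))
  (U_delta : forall i j s (eta : orthocompl (range (V j))),
     ends_with_inv j s -> s <> (free_gen i)^-1%g ->
     U i (inj j (tens j (delta j s) eta)) =
     inj j (tens j (delta j (free_gen i * s)%g) eta))
  (pi : free_group n -> {linear H -> H})
  (pi_rep : unitary_representation pi)
  (pi_gen : forall i x, pi (free_gen i) x = U i x) :
  forall s : free_group n,
    (phi a s)%:C = '[pi s (inj0 (Delta 1%g)), inj0 (Delta 1%g)].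
Proof.
have [_ pi1 piM] := pi_rep.
have [[inj0_iso _] inj0_inj _ _] := H_sum.
have pi_genV i x : pi (free_gen i)^-1%g (U i x) = x.
  by rewrite -pi_gen -piM mulVg pi1.
have pi_pos s t : free_pos s -> free_pos t ->
    pi s (inj0 (Delta t)) = inj0 (Delta (s * t)%g).
  move=> s_pos; elim: s_pos t => [t _|i t t_pos|s1 s2 _ IH1 s2_pos IH2 t t_pos].
  - by rewrite pi1 mul1g.
  - by rewrite pi_gen U_H0 V_Delta.
  - by rewrite piM IH2 // IH1 ?mulgA //; apply: free_posM.
have pi_delta s i eta : reduced (word s ++ [:: (i, true)]) ->
    pi s (inj i (tens i (delta i (free_gen i)^-1%g) eta)) =
    inj i (tens i (delta i (s * (free_gen i)^-1)%g) eta).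
  case: s => w; elim: w => [|[j b] w IHw] w_red wi.
    have -> : FreeGroup w_red = 1%g by apply/val_inj.
    by rewrite pi1 mul1g.
  rewrite free_group_cons piM IHw ?(reduced_behead wi) //.
  set s := FreeGroup _.
  have sE : word (s * (free_gen i)^-1)%g = w ++ [:: (i, true)].
    by rewrite word_mulg_cat // (reduced_behead wi).
  rewrite -mulgA; case: b w_red wi @s sE => w_red wi s sE.
  (* For a letter u_j^-1, apply U_j to the target instead: its index has at least two letters, hence
     is not u_j^-1. *)
  - rewrite -[RHS](pi_genV j) U_delta ?mulVKg //.
      by exists ((j, true) :: w); rewrite word_mulg_cat sE // -cats1.
    move=> /(congr1 (fun t : free_group n => word t)).
    rewrite word_mulg_cat sE //; by case: (w).
  (* For a letter u_j, the excluded index u_j^-1 would make the whole word u_j u_j^-1, which is not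
     reduced. *)
  - rewrite pi_gen U_delta //; first by exists w; rewrite sE cats1.
    move=> /(congr1 (fun t : free_group n => word t)); rewrite sE => wE.
    by move: wi; rewrite /= wE /reduced /= eqxx.
have eta_orth i r : free_pos r -> reduced ((i, true) :: word r) ->
    Delta r - (phi a ((free_gen i)^-1 * r)%g)%:C *: Delta (free_gen i)
      \in orthogonal_to (range (V i)).
  move=> r_pos ir; apply/orthogonal_toP => _ [y _ <-].
  have : closed_span (Delta @` @free_pos n) y by rewrite Delta_span.
  apply: (orthogonal_closed_span (V_isometric i)) => _ [s s_pos <-].
  have gi := free_pos_gen i.
  have irE : word ((free_gen i)^-1 * r)%g = (i, true) :: word r.
    by rewrite word_mulg_cat.
  rewrite V_Delta // linearBl /= linearZl_LR /= !Delta_gram //;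
    try exact: free_posM.
  (* The Gram entries are phi(s^-1 u_i^-1 r) and phi(s^-1); the first factors at the cut after
     s^-1. *)
  rewrite invgM -!mulgA mulVg mulg1 (phi_cat _ irE) ?irE.
    by rewrite rmorphM mulrC subrr.
  exact: positive_word_inv_cat.
have pi_gen_inv i r (r_pos : free_pos r) (ir : reduced ((i, true) :: word r)) :
    pi (free_gen i)^-1%g (inj0 (Delta r)) =
    (phi a ((free_gen i)^-1 * r)%g)%:C *: inj0 (Delta 1%g)
    + inj i (tens i (delta i (free_gen i)^-1%g)
        (OrthoCompl (eta_orth i r r_pos ir))).
  (* U_i sends the right side to phi(u_i^-1 r) Delta_(u_i) + eta, which is Delta_r by the choice of
     eta. *)
  rewrite -[RHS](pi_genV i) linearD linearZ /= U_H0 U_inv /= V_Delta ?mulg1.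
    by rewrite linearB linearZ /= addrC subrK.
  exact: free_pos1.
(* Induction on length: the prefix s' omits at least the letter u_i^-1. *)
move=> s; have [k] := ubnP (size (word s)); elim: k s => // k IHk s.
have [s_pos _|[s' [i [r [r_pos wE sE]]]]] := free_pos_or_last_inverse s.
  rewrite pi_pos ?mulg1 //; last exact: free_pos1.
  by rewrite inj0_iso Delta_gram ?invg1 ?mul1g //; exact: free_pos1.
rewrite wE => sk; have s_red := word_reduced s; rewrite wE in s_red.
have := s_red; rewrite reduced_cat => /andP[s'i ir].
have irE : word ((free_gen i)^-1 * r)%g = (i, true) :: word r.
  by rewrite word_mulg_cat.
rewrite sE (phi_cat _ irE) ?irE // !piM pi_pos ?mulg1 //; last exact: free_pos1.
rewrite pi_gen_inv linearD linearZ /= pi_delta ?cats1 //.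
rewrite linearDl /= linearZl_LR /= [X in _ + X]dotpC inj0_inj conjC0 addr0.
rewrite -IHk; last by move: sk; rewrite size_cat /=; lia.
by rewrite -rmorphM mulrC.
Qed.
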